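(* Let $p$ be an odd prime and let $0\le r\le p-1$. Then, as polynomials in $x$, $$P_r(x)^2\equiv 1+P_r(2x^2-1)+2\sum_{y\in\mathbb F_p^\times\setminus\mathbb F_p^{\times2}}P_r\left(\frac{y+1-2x^2}{y-1}\right) \mod p,$$ where the sum ranges over the quadratic non-residues $y$ in $\mathbb F_p^\times$.
   Context: $P_r(x)\in\mathbb Z[\frac12][x]$ is the $r$-th Legendre polynomial, defined by $P_0(x)=1$, $P_1(x)=x$, $(r+1)P_{r+1}(x)=(2r+1)xP_r(x)-rP_{r-1}(x)$. Its coefficients lie in $\mathbb Z[\frac12]$, so it can be reduced modulo the odd prime $p$; the congruence is an identity in $\mathbb F_p[x]$. *)

(* Defs.v *)
From HB Require Import structures.
From mathcomp Require Import all_boot all_order all_algebra.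

Set Implicit Arguments.
Unset Strict Implicit.
Unset Printing Implicit Defensive.

Import GRing.Theory Num.Theory.
Local Open Scope ring_scope.

(* The recurrence (n+1) P_{n+1} = (2n+1) x P_n - n P_{n-1}, solved for P_{n+1}
   with n = r0.+1; legendreS below restates it in that form. *)
Fixpoint legendre (r : nat) : {poly rat} :=
  match r with
  | 0 => 1
  | r1.+1 =>
    match r1 with
    | 0 => 'X
    | r0.+1 => (r1.+1%:R)^-1 *:
        ((2 * r1 + 1)%:R *: ('X * legendre r1) - r1%:R *: legendre r0)
    end
  end.

Lemma legendre0 : legendre 0 = 1.
Proof. by []. Qed.

Lemma legendre1 : legendre 1 = 'X.
Proof. by []. Qed.

Lemma legendreS (r : nat) : (0 < r)%N ->
  r.+1%:R *: legendre r.+1 =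
  (2 * r + 1)%:R *: ('X * legendre r) - r%:R *: legendre r.-1.
Proof.
case: r => // r _; rewrite -[r.+1.-1]/r.
rewrite [legendre r.+2]/= scalerA divff ?scale1r //.
by rewrite pnatr_eq0.
Qed.

(* Coefficientwise reduction modulo p.  ratr maps a reduced fraction a / b to
   a%:~R / b%:~R in 'F_p, so it is the canonical ring morphism on rationals with
   denominator prime to p, in particular on Z[1/2] for odd p.  On other
   rationals its value is meaningless. *)
Definition legendre_mod (p r : nat) : {poly 'F_p} :=
  map_poly (ratr : rat -> 'F_p) (legendre r).

(* Membership in F_p^* minus the subgroup of squares of F_p^*. *)
Definition nonresidue (p : nat) (y : 'F_p) : bool :=
  (y != 0) && ~~ [exists z : 'F_p, (z != 0) && (y == z ^+ 2)].

(* Main.v *)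
Require Import Defs.
From HB Require Import structures.
From mathcomp Require Import all_boot all_order all_algebra.
From mathcomp Require Import cyclic finfield.
From mathcomp Require Import ring zify.

Set Implicit Arguments.
Unset Strict Implicit.
Unset Printing Implicit Defensive.

Import GRing.Theory Num.Theory.
Local Open Scope ring_scope.

(** Put u = (1 - x) / 2.  Then P_r(x) = sum_k a_k u^k with the integers
    a_k = (-1)^k C(r, k) C(r + k, k) (legendre_comp), and both kinds of argument on
    the right-hand side of the congruence are simple in this coordinate: with
    w = x^2 - 1, the coordinate u of 2x^2 - 1 is - w, and that of
    (y + 1 - 2x^2) / (y - 1) is w / (y - 1).  The right-hand side is therefore
    1 + sum_k a_k ((-1)^k + 2 S_k) w^k, where S_k is the sum of (y - 1)^(-k) over the
    nonresidues y.

    By Euler's criterion 2 S_k is, up to the term y = 0, the sum over all of F_p of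
    (y - 1)^(p - 1 - k) (1 - y^m) with m = (p - 1) / 2, and power sums over F_p read off
    the coefficient of degree p - 1 after the shift y = t + 1.  This gives
    2 S_k = C(m, k) - (-1)^k - [k = 0] (sum_nonsquare), so that the right-hand side
    collapses to sum_k a_k C(m, k) w^k.

    Since m = - 1 / 2 in F_p, C(m, k) = (- 1 / 4)^k C(2k, k) there (bin_half_mod).  What
    remains is a characteristic-zero identity, a case of Clausen's formula:
    (sum_k a_k u^k)^2 = sum_k a_k C(2k, k) (u - u^2)^k (clausen_legendre), where
    u - u^2 = - w / 4.  Both sides are annihilated by the symmetric square of the
    Legendre differential operator, and a polynomial solution of that third-order
    equation is determined by its constant term. *)

(** * Legendre polynomials in the coordinate (1 - x) / 2 *)

Definition legendre_binom (n k : nat) : nat := 'C(n, k) * 'C(n + k, k).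

Lemma legendre_binom_small n k : (n < k)%N -> legendre_binom n k = 0%N.
Proof. by move=> lt_nk; rewrite /legendre_binom bin_small. Qed.

(** The ratio of consecutive coefficients, which amounts to the Legendre
    differential equation. *)
Lemma legendre_binomSr n k :
  (k.+1 ^ 2 * legendre_binom n k.+1 =
   (n - k) * (n + k.+1) * legendre_binom n k)%N.
Proof.
rewrite /legendre_binom.
have e1 := mul_bin_left n k.
have := mul_bin_diag (n + k.+1) k; rewrite addnS /= -addnS => e2.
transitivity ((k.+1 * 'C(n, k.+1)) * (k.+1 * 'C(n + k.+1, k.+1)))%N; first by ring.
by rewrite e1 -e2; ring.
Qed.

Lemma legendre_binomSl n k :
  ((n.+1 - k) * legendre_binom n.+1 k = (n.+1 + k) * legendre_binom n k)%N.
Proof.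
rewrite /legendre_binom.
have e1 := mul_bin_down n.+1 k.
have := mul_bin_down (n.+1 + k) k; rewrite addnK addSn /= => e2.
apply/eqP; rewrite -(eqn_pmul2l (ltn0Sn n)); apply/eqP.
transitivity (((n.+1 - k) * 'C(n.+1, k)) * (n.+1 * 'C((n + k).+1, k)))%N.
  by ring.
by rewrite -e1 -e2 /=; ring.
Qed.

Definition legendre_coef (n k : nat) : int := (-1) ^+ k * (legendre_binom n k)%:R.

Lemma legendre_coef0 n : legendre_coef n 0 = 1.
Proof. by rewrite /legendre_coef /legendre_binom !bin0. Qed.

Lemma legendre_coefSr n k :
  (k.+1%:R ^+ 2 : int) * legendre_coef n k.+1 =
  (k%:R * k.+1%:R - (n * n.+1)%:R) * legendre_coef n k.
Proof.
rewrite /legendre_coef [(-1) ^+ k.+1]exprS.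
have := congr1 (fun x => x%:R : int) (legendre_binomSr n k).
case: (leqP k n) => [le_kn | lt_nk].
  move: (legendre_binom n k) (legendre_binom n k.+1) => b b'.
  rewrite !natrM natrB // natrD => e.
  transitivity (- (-1) ^+ k * (k.+1%:R * k.+1%:R * b'%:R : int)).
    by ring.
  by rewrite e; ring.
by rewrite !legendre_binom_small ?mulr0 // ltnW.
Qed.

(** The coefficient form of the three-term recurrence.  All four binomial products
    are rational multiples of the one with indices n + 1 and k + 1, so that
    after clearing denominators only a polynomial identity is left.  The
    denominators vanish when k = n + 1, where the claim is the recurrence of the
    central binomial coefficients. *)
Lemma legendre_coef_rec n k :
  n.+2%:R * legendre_coef n.+2 k.+1 =
  (2 * n.+1 + 1)%:R * (legendre_coef n.+1 k.+1 - 2 * legendre_coef n.+1 k)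
  - n.+1%:R * legendre_coef n k.+1.
Proof.
rewrite /legendre_coef [(-1) ^+ k.+1]exprS.
suff e : (n.+2 * legendre_binom n.+2 k.+1 + n.+1 * legendre_binom n k.+1 =
  (2 * n.+1 + 1) * (legendre_binom n.+1 k.+1 + 2 * legendre_binom n.+1 k))%N.
  have := congr1 (fun x => x%:R : int) e.
  move: (legendre_binom n.+2 k.+1) (legendre_binom n k.+1) (legendre_binom n.+1 k.+1)
    (legendre_binom n.+1 k) => b2 b0 b1 b1'.
  rewrite !(natrM, natrD) => {}e.
  have {}e := congr1 (fun x => - (-1) ^+ k * x) e.
  apply: (addIr (n.+1%:R * (-1 * (-1) ^+ k * b0%:R))).
  rewrite subrK; apply: etrans (etrans e _); by ring.
have e1 := legendre_binomSl n.+1 k.+1.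
have e2 := legendre_binomSl n k.+1.
have e3 := legendre_binomSr n.+1 k.
have [lt_nk|le_kn] := ltnP n.+1 k.
  by rewrite !legendre_binom_small //; lia.
case: (ltngtP k n.+1) le_kn => // [lt_kn _|-> _].
  apply/eqP; rewrite -(eqn_pmul2l (_ : 0 < (n.+2 - k.+1) * (n.+1 + k.+1))%N); last by lia.
  apply/eqP.
  transitivity (n.+2 * (n.+1 + k.+1) * ((n.+2 - k.+1) * legendre_binom n.+2 k.+1)
   + n.+1 * (n.+2 - k.+1) * ((n.+1 + k.+1) * legendre_binom n k.+1))%N; first by ring.
  rewrite e1 -e2.
  transitivity ((2 * n.+1 + 1) * ((n.+2 - k.+1) * (n.+1 + k.+1) * legendre_binom n.+1 k.+1
     + 2 * (k.+1 ^ 2 * legendre_binom n.+1 k.+1)))%N; last first.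
    by rewrite e3 subSS; ring.
  have -> : n.+1 = (k + (n - k)).+1 by lia.
  move: (n - k)%N => d.
  have -> : ((k + d).+2 - k.+1 = d.+1)%N by lia.
  have -> : ((k + d).+1 - k.+1 = d)%N by lia.
  by ring.
rewrite (@legendre_binom_small n.+1) // (@legendre_binom_small n) // /legendre_binom !binn.
rewrite !mul1n muln0 addn0 add0n.
have f1 := mul_bin_diag (n.+2 + n.+2) n.+1; rewrite addnS /= in f1.
have f2 := mul_bin_down (n.+1 + n.+2) n.+1; rewrite addnS /= in f2.
move: f1 f2; rewrite -!addnS.
have -> : ((n.+1 + n.+2) - n.+1 = n.+2)%N by lia.
have -> : 'C(n.+1 + n.+2, n.+1) = 'C((n.+2 + n.+2).-1, n.+1) by congr ('C(_, _)); lia.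
move=> f1 f2.
apply/eqP; rewrite -(eqn_pmul2l (ltn0Sn n.+1)); apply/eqP.
rewrite -f1.
transitivity (2 * (n.+2 * (n.+2 * 'C((n.+2 + n.+2).-1, n.+1))))%N.
  by rewrite addnS; ring.
by rewrite -f2; ring.
Qed.

Definition legendre_shift (n : nat) : {poly int} :=
  \poly_(k < n.+1) legendre_coef n k.

Lemma coef_legendre_shift n k : (legendre_shift n)`_k = legendre_coef n k.
Proof.
rewrite coef_poly ltnS; case: leqP => // lt_nk.
by rewrite /legendre_coef legendre_binom_small // mulr0.
Qed.

Lemma legendre_shift_rec n :
  n.+2%:R *: legendre_shift n.+2 =
  (2 * n.+1 + 1)%:R *: ((1 - 2 *: 'X) * legendre_shift n.+1)
    - n.+1%:R *: legendre_shift n.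
Proof.
apply/polyP => -[|k].
  rewrite mulrBl mul1r -scalerAl !(coefB, coefZ, coefXM, coef_legendre_shift) /= !legendre_coef0.
  by rewrite !(natrM, natrD) -!natr1; ring.
rewrite mulrBl mul1r -scalerAl !(coefB, coefZ, coefXM, coef_legendre_shift) /=.
exact: legendre_coef_rec.
Qed.

(** * Clausen's formula for the square *)

(** Unlike coefE, this set has no rule for explicitly given polynomials: such a rule
    would unfold named polynomials and hide the lemmas on their coefficients. *)
Definition coefR := (coefB, coefD, coefZ, coefXM, coefXnM, coef_deriv).

(** In terms of this operator, u (1 - u) d/du, the Legendre equation for f with
    parameter lam is (theta_poly f)' = - lam f. *)
Definition theta_poly (R : comNzRingType) (Y : {poly R}) : {poly R} := ('X - 'X^2) * Y^`().

(** The symmetric square of the Legendre operator: the third-order operator whose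
    solutions are spanned by the products of two solutions of the Legendre
    equation. *)
Definition sym2_legendre (R : comNzRingType) (lam : R) (Y : {poly R}) : {poly R} :=
  (theta_poly (theta_poly Y))^`() + (4 * lam) *: theta_poly Y
  + (2 * lam) *: ((1 - 2 *: 'X) * Y).

Lemma deriv_XsubX2 (R : comNzRingType) : ('X - 'X^2 : {poly R})^`() = 1 - 2 *: 'X.
Proof. by rewrite !derivE scaler_nat. Qed.

Lemma coef_theta0 (R : comNzRingType) (Y : {poly R}) : (theta_poly Y)`_0 = 0.
Proof. by rewrite /theta_poly mulrBl !coefR subr0. Qed.

Lemma coef_thetaS (R : comNzRingType) (Y : {poly R}) i :
  (theta_poly Y)`_i.+1 = i.+1%:R * Y`_i.+1 - i%:R * Y`_i.
Proof.
rewrite /theta_poly mulrBl !coefR /= mulr_natl; congr (_ - _).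
case: i => [|[|i]] /=; rewrite ?mul0r ?mul1r // !subSS subn0 mulr_natl.
by [].
Qed.

Lemma sym2_legendreB (R : comNzRingType) (lam : R) (Y Z : {poly R}) :
  sym2_legendre lam (Y - Z) = sym2_legendre lam Y - sym2_legendre lam Z.
Proof.
rewrite /sym2_legendre /theta_poly !(derivB, mulrBr, derivM) -!mul_polyC.
by ring.
Qed.

(** With g = u (1 - u) f', the equation g' = - lam f makes
    theta (theta (f^2)) equal to 2 (g^2 - lam u (1 - u) f^2); differentiating once
    more leaves only multiples of f g and of f^2, which the two lower-order
    terms cancel. *)
Lemma sym2_legendre_sqr (R : comNzRingType) (lam : R) (f : {poly R}) :
  (theta_poly f)^`() = - lam *: f -> sym2_legendre lam (f ^+ 2) = 0.
Proof.
move=> ode; rewrite /sym2_legendre.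
have -> : theta_poly (f ^+ 2) = 2 *: (theta_poly f * f).
  by rewrite /theta_poly expr2 derivM scaler_nat; ring.
have -> : theta_poly (2 *: (theta_poly f * f)) =
    2 *: (theta_poly f ^+ 2 - lam *: (('X - 'X^2) * f ^+ 2)).
  rewrite {1}/theta_poly derivZ derivM ode -!mul_polyC /theta_poly polyCN.
  by ring.
have -> : theta_poly f * f = ('X - 'X^2) * (f * f^`()) by rewrite /theta_poly; ring.
have gE : theta_poly f = ('X - 'X^2) * f^`() by [].
(* theta_poly f is made opaque, as derivM would otherwise expand it. *)
move: (theta_poly f) ode gE => g ode gE.
rewrite derivZ derivB derivZ !expr2 !derivM deriv_XsubX2 ode.
rewrite [in LHS]gE -!mul_polyC !polyCM !polyCN.
by ring.
Qed.

(** On functions of s = u - u^2 the operator factors as s' times an operator in s,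
    because (s')^2 = 1 - 4 s is again a function of s.  The recurrence says that the
    latter operator annihilates h. *)
Lemma sym2_legendre_comp (R : comNzRingType) (lam : R) (h : {poly R}) :
  (forall k, k.+1%:R ^+ 3 * h`_k.+1 =
     2 * (2 * k%:R + 1) * (k%:R * k.+1%:R - lam) * h`_k) ->
  sym2_legendre lam (h \Po ('X - 'X^2)) = 0.
Proof.
move=> hrec.
set s : {poly R} := 'X - 'X^2.
pose h1 := 'X * h^`(); pose h2 := 'X * ((1 - 4 *: 'X) * h1^`() - 2 *: h1).
have sE : (1 - 2 *: 'X) ^+ 2 = 1 - 4 *: s.
  by rewrite /s -!mul_polyC; ring.
have e1 : theta_poly (h \Po s) = (h1 \Po s) * (1 - 2 *: 'X).
  by rewrite /theta_poly deriv_comp deriv_XsubX2 comp_polyM comp_polyX -/s mulrA.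
have e2 g : theta_poly ((g \Po s) * (1 - 2 *: 'X)) =
    ('X * ((1 - 4 *: 'X) * g^`() - 2 *: g)) \Po s.
  rewrite /theta_poly derivM deriv_comp deriv_XsubX2 -mulrA -expr2 sE -/s.
  rewrite comp_polyM comp_polyX comp_polyB comp_polyM comp_polyB !comp_polyZ comp_polyX comp_polyC.
  by rewrite derivB derivZ derivX derivC -!mul_polyC; ring.
rewrite /sym2_legendre e1 e2 -/h2 deriv_comp deriv_XsubX2.
pose M := h2^`() + (4 * lam) *: h1 + (2 * lam) *: h.
suff M0 : M = 0.
  transitivity ((M \Po s) * (1 - 2 *: 'X)); last by rewrite M0 comp_poly0 mul0r.
  by rewrite /M !comp_polyD !comp_polyZ -!mul_polyC; ring.
have h1E i : h1`_i = i%:R * h`_i.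
  by rewrite /h1 !coefR; case: i => [|i] /=; rewrite ?mul0r // mulr_natl.
rewrite /M /h2; clearbody h1.
apply/polyP => k; rewrite mulrBl mul1r -scalerAl !coefR coef0 /=.
have -> : (if k == 0%N then 0 else h1`_k.-1.+1 *+ k.-1.+1) = k%:R ^+ 2 * h`_k.
  case: k => [|k] /=; first by rewrite expr2 !mul0r.
  by rewrite h1E; ring.
rewrite !h1E.
transitivity (k.+1%:R ^+ 3 * h`_k.+1 -
  2 * (2 * k%:R + 1) * (k%:R * k.+1%:R - lam) * h`_k); first by ring.
by rewrite hrec subrr.
Qed.

(** The operator sends u^n to n^3 u^(n - 1) plus higher-order terms, so the
    coefficients of a solution are determined one after the other by the first. *)
Lemma sym2_legendre_inj (lam : int) (Y : {poly int}) :
  sym2_legendre lam Y = 0 -> Y`_0 = 0 -> Y = 0.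
Proof.
move=> LY Y0; apply/polyP => n; rewrite coef0.
elim/ltn_ind: n => -[//|n] IH.
have D0 i : (i <= n)%N -> (theta_poly Y)`_i = 0.
  case: i => [|i] lein; first exact: coef_theta0.
  by rewrite coef_thetaS !IH ?ltnS ?(ltnW lein) // !mulr0 subrr.
have := congr1 (fun P : {poly int} => P`_n) LY.
rewrite /sym2_legendre coef0 mulrBl mul1r -scalerAl !coefR.
rewrite coef_thetaS (D0 n) // coef_thetaS (IH n) //.
have -> : (if n == 0 then 0 else Y`_n.-1) = 0.
  by case: n IH {D0} => //= n IH; rewrite IH.
move=> e.
have /eqP : n.+1%:R ^+ 3 * Y`_n.+1 = 0 by rewrite -[RHS]e; ring.
by rewrite mulf_eq0 expf_eq0 pnatr_eq0 => /eqP.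
Qed.

Lemma legendre_shift_ode n :
  (theta_poly (legendre_shift n))^`() =
  - (n * n.+1)%:R *: legendre_shift n.
Proof.
apply/polyP => k; rewrite coef_deriv coefZ coef_thetaS !coef_legendre_shift -mulr_natl.
have e := legendre_coefSr n k.
transitivity ((k.+1%:R ^+ 2 : int) * legendre_coef n k.+1 - k.+1%:R * k%:R * legendre_coef n k).
  by ring.
by rewrite e; ring.
Qed.

Lemma central_binS k : (k.+1 * 'C(2 * k.+1, k.+1) = 2 * (2 * k + 1) * 'C(2 * k, k))%N.
Proof.
have e1 := mul_bin_diag (2 * k.+1) k.
have e2 := mul_bin_down (2 * k).+1 k.
rewrite mulnS /= in e1; rewrite /= in e2.
have -> : (2 * k.+1 = (2 * k).+2)%N by lia.
rewrite -e1 add1n.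
have e3 : ((2 * k).+1 - k = k.+1)%N by lia.
rewrite e3 in e2.
transitivity (2 * (k.+1 * 'C((2 * k).+1, k)))%N; first by ring.
by rewrite -e2; ring.
Qed.

Definition clausen_poly (n : nat) : {poly int} :=
  \poly_(k < n.+1) (legendre_coef n k * 'C(2 * k, k)%:R).

Lemma coef_clausen_poly n k :
  (clausen_poly n)`_k = legendre_coef n k * 'C(2 * k, k)%:R.
Proof.
rewrite coef_poly ltnS; case: leqP => // lt_nk.
by rewrite /legendre_coef legendre_binom_small // mulr0 mul0r.
Qed.

(** Both sides are solutions of the same third-order equation with constant
    term 1. *)
Lemma clausen_legendre n :
  legendre_shift n ^+ 2 = clausen_poly n \Po ('X - 'X^2).
Proof.
apply/eqP; rewrite -subr_eq0; apply/eqP.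
apply: (@sym2_legendre_inj (n * n.+1)%:R).
  rewrite sym2_legendreB sym2_legendre_sqr; last exact: legendre_shift_ode.
  rewrite sym2_legendre_comp ?subrr // => k.
  rewrite !coef_clausen_poly.
  have e1 := legendre_coefSr n k.
  have := congr1 (fun x => x%:R : int) (central_binS k).
  move: 'C(2 * k.+1, k.+1) 'C(2 * k, k) => c' c.
  rewrite !(natrM, natrD) => e2.
  transitivity ((k.+1%:R ^+ 2 * legendre_coef n k.+1) * (k.+1%:R * c'%:R)).
    by ring.
  by rewrite e1 e2; ring.
have -> : 'X - 'X^2 = 'X * (1 - 'X) :> {poly int} by ring.
rewrite -horner_coef0 hornerD hornerN horner_exp horner_comp hornerM hornerX mul0r.
by rewrite !horner_coef0 coef_legendre_shift coef_clausen_poly legendre_coef0 bin0 subrr.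
Qed.

(** * Power sums and squares in a finite field *)

Lemma expf_card1 (F : finFieldType) (x : F) : x != 0 -> x ^+ (#|F| - 1) = 1.
Proof.
move=> x0; apply: (mulfI x0); rewrite -exprS mulr1 subn1 prednK ?expf_card //.
by apply/card_gt0P; exists 0.
Qed.

Lemma exists_prim_root (F : finFieldType) : {g : F | (#|F| - 1).-primitive_root g}.
Proof.
have card1 := finNzRing_gt1 F.
have /hasP/sig2W[g _ gP] : has (#|F| - 1).-primitive_root (enum (predC1 (0 : F))).
  apply: has_prim_root; first by rewrite subn_gt0.
  - apply/allP => x; rewrite mem_enum => x0.
    by apply/unity_rootP; exact: expf_card1.
  - exact: enum_uniq.
  - by rewrite subn1 -(cardC1 (0 : F)) cardE.
by exists g.
Qed.

(** For 0 < n < q - 1 the sum is invariant under multiplication by g^n, where g is a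
    generator, and g^n is not 1.  For n = 0 the convention 0^0 = 1 gives q = 0. *)
Lemma sum_exprn (F : finFieldType) (n : nat) : (n < 2 * (#|F| - 1))%N ->
  \sum_(x : F) x ^+ n = - (n == #|F| - 1)%N%:R.
Proof.
have card1 := finNzRing_gt1 F.
have sum1 : #|F|%:R = 0 :> F.
  have /eqP : \sum_(x : F) x = \sum_(x : F) (x + 1).
    by rewrite [LHS](reindex_inj (addIr 1)).
  rewrite big_split /= sumr_const -[X in X == _]addr0 eq_sym.
  by rewrite (inj_eq (addrI _)) => /eqP.
have small k : (k < #|F| - 1)%N -> \sum_(x : F) x ^+ k = 0.
  case: k => [|k] ltk.
    by rewrite (eq_bigr (fun=> 1)) ?sumr_const // => x _; rewrite expr0.
  have [g gP] := (exists_prim_root F).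
  have g0 : g != 0.
    by rewrite (prim_root_eq0 gP) -lt0n subn_gt0.
  have gk : g ^+ k.+1 != 1.
    by rewrite -(prim_order_dvd gP) gtnNdvd.
  have /eqP : \sum_(x : F) x ^+ k.+1 = \sum_(x : F) (g * x) ^+ k.+1.
    by rewrite [LHS](reindex_inj (mulfI g0)).
  rewrite [X in _ == X](eq_bigr (fun x => g ^+ k.+1 * x ^+ k.+1)); last by move=> x _; rewrite exprMn.
  rewrite -mulr_sumr eq_sym -subr_eq0 -[X in _ - X]mul1r -mulrBl mulf_eq0 subr_eq0.
  by rewrite (negPf gk) => /eqP.
have card0 : (0 < #|F| - 1)%N by rewrite subn_gt0.
case: (ltngtP n (#|F| - 1)%N) => [ltn _|gtn ltn|-> _]; first by rewrite small ?oppr0.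
  rewrite oppr0; transitivity (\sum_(x : F) x ^+ (n - (#|F| - 1))); last first.
    by apply: small; rewrite ltn_subLR ?(ltnW gtn) // addnn -mul2n.
  apply: eq_bigr => x _; have [->|x0] := eqVneq x 0.
    by rewrite !expr0n subn_eq0 leqNgt gtn (gtn_eqF (ltn_trans card0 gtn)).
  by rewrite -[in LHS](subnK (ltnW gtn)) exprD expf_card1 // mulr1.
rewrite (bigD1 0) //= expr0n eqn0Ngt card0 add0r.
rewrite (eq_bigr (fun=> 1)); last by move=> x x0; rewrite expf_card1.
rewrite sumr_const cardC1 -subn1 natrB; last exact: ltnW.
by rewrite sum1 sub0r.
Qed.

Lemma sum_horner (F : finFieldType) (h : {poly F}) : (size h <= 2 * (#|F| - 1))%N ->
  \sum_(x : F) h.[x] = - h`_(#|F| - 1).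
Proof.
move=> szh; pose d := (2 * (#|F| - 1))%N.
rewrite (eq_bigr (fun x => \sum_(i < d) h`_i * x ^+ i)); last first.
  by move=> x _; rewrite (horner_coef_wide _ szh).
rewrite exchange_big /=.
rewrite (eq_bigr (fun i : 'I_d => if (i : nat) == (#|F| - 1)%N then - h`_i else 0)); last first.
  by move=> i _; rewrite -mulr_sumr sum_exprn //; case: eqP; rewrite ?mulrN1 ?oppr0 ?mulr0.
rewrite -big_mkcond /=.
have lt_d : (#|F| - 1 < d)%N by rewrite /d mul2n -addnn -addn1 leq_add2l subn_gt0 finNzRing_gt1.
by rewrite (big_pred1 (Ordinal lt_d)) //.
Qed.

Lemma euler_nonsquare (F : finFieldType) (y : F) : odd #|F| -> y != 0 ->
  ~~ [exists z : F, (z != 0) && (y == z ^+ 2)] -> y ^+ (#|F| - 1)./2 = -1.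
Proof.
move=> oddF y0 nsq; set m := (#|F| - 1)./2.
have card1 := finNzRing_gt1 F.
have m2 : (m * 2 = #|F| - 1)%N.
  by rewrite muln2 /m even_halfK // oddB ?oddF // ltnW.
have : y ^+ m ^+ 2 == 1 by rewrite -exprM m2 expf_card1.
rewrite sqrf_eq1 => /orP[|/eqP //] /eqP ym1; case/negP: nsq.
have [g gP] := (exists_prim_root F).
have [i def_y] : exists i, y = g ^+ i.
  by have [i ->] := prim_rootP gP (expf_card1 y0); exists i.
have m0 : (0 < m)%N by rewrite -(ltn_pmul2r (isT : 0 < 2)%N) m2 subn_gt0.
move/eqP: ym1; rewrite def_y -exprM -(prim_order_dvd gP) -m2.
rewrite mulnC dvdn_pmul2r // => dvd2i; apply/existsP; exists (g ^+ (i %/ 2)).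
rewrite -exprM divnK // eqxx andbT expf_neq0 //.
by rewrite (prim_root_eq0 gP) -lt0n subn_gt0.
Qed.

Lemma euler_square (F : finFieldType) (z : F) : odd #|F| -> z != 0 ->
  (z ^+ 2) ^+ (#|F| - 1)./2 = 1.
Proof.
move=> oddF z0; rewrite -exprM mul2n even_halfK ?expf_card1 //.
by rewrite oddB ?oddF // ltnW // finNzRing_gt1.
Qed.

(** The factor 1 - y^m is 2 on nonsquares and 0 on nonzero squares, so the sum
    extends to the whole field except for the term y = 0, which contributes the
    (-1)^k.  Inverses become polynomial through t^(-k) = t^(q - 1 - k), which can fail
    only at t = y - 1 = 0, where the factor 1 - y^m vanishes. *)
Lemma sum_nonsquare (F : finFieldType) (k : nat) : odd #|F| -> (k <= #|F| - 1)%N ->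
  2 * (\sum_(y : F | (y != 0) && ~~ [exists z : F, (z != 0) && (y == z ^+ 2)])
        (y - 1)^-1 ^+ k) =
  'C((#|F| - 1)./2, k)%:R - (-1) ^+ k - (k == 0%N)%:R.
Proof.
move=> oddF le_k; set m := (#|F| - 1)./2; set q1 := (#|F| - 1)%N.
have card1 := finNzRing_gt1 F.
have m2 : (m * 2 = q1)%N.
  by rewrite muln2 /m even_halfK // oddB ?oddF // ltnW.
pose h : {poly F} := ('X - 1) ^+ (q1 - k) * (1 - 'X ^+ m).
have pow_inv (t : F) : t != 0 -> t^-1 ^+ k = t ^+ (q1 - k).
  move=> t0; apply: (mulfI (expf_neq0 k t0)).
  by rewrite -exprMn divff // expr1n -exprD subnKC // expf_card1.
have m0 : (0 < m)%N by rewrite -(ltn_pmul2r (isT : 0 < 2)%N) m2 subn_gt0.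
have sqh (y : F) : y != 0 -> [exists z : F, (z != 0) && (y == z ^+ 2)] -> h.[y] = 0.
  move=> y0 /existsP[z /andP[z0 /eqP->]].
  by rewrite /h !hornerE euler_square // subrr mulr0.
rewrite mulr_sumr.
transitivity (\sum_(y : F | y != 0) h.[y]).
  rewrite [RHS](bigID (fun y : F => [exists z : F, (z != 0) && (y == z ^+ 2)])) /=.
  rewrite [X in _ = X + _]big1; last by move=> y /andP[y0 sq]; exact: sqh.
  rewrite add0r.
  apply: eq_bigr => y /andP[y0 nsq].
  have y1 : y - 1 != 0.
    rewrite subr_eq0; apply: contraNneq nsq => ->.
    by apply/existsP; exists 1; rewrite oner_eq0 expr1n eqxx.
  rewrite pow_inv // /h !hornerE euler_nonsquare //.
  by rewrite opprK mulrC.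
have -> : \sum_(y : F | y != 0) h.[y] = \sum_(y : F) h.[y] - h.[0].
  by rewrite [in RHS](bigD1 0) //= addrAC subrr add0r.
have -> : h.[0] = (-1) ^+ k.
  rewrite /h !hornerE expr0n (gtn_eqF m0) /= subr0 mulr1.
  apply: (mulfI (expf_neq0 k (_ : -1 != 0 :> F))); first by rewrite oppr_eq0 oner_neq0.
  rewrite -exprD subnKC // -m2 mulnC exprM sqrrN !expr1n.
  by rewrite -exprMn mulrNN mulr1 expr1n.
rewrite (reindex_inj (addIr (1 : F))) /=.
(* After the shift, the coefficient of degree q - 1 in h' is the coefficient of
   degree k in 1 - ('X + 1) ^+ m. *)
pose h' : {poly F} := 'X^(q1 - k) * (1 - ('X + 1) ^+ m).
rewrite (eq_bigr (fun x => h'.[x])); last first.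
  by move=> x _; rewrite /h /h' !hornerE addrK.
have coefh i : (('X + 1 : {poly F}) ^+ m)`_i = 'C(m, i)%:R.
  rewrite addrC exprDn coef_sum.
  under eq_bigr => j _ do rewrite expr1n mul1r coefMn coefXn.
  have [le_im|lt_mi] := leqP i m.
    rewrite (bigD1 (inord i)) //= inordK ?ltnS // eqxx big1 ?addr0 // => j.
    rewrite -val_eqE /= inordK ?ltnS // => /negPf ji.
    by rewrite eq_sym ji mul0rn.
  rewrite bin_small // big1 // => j _.
  by rewrite gtn_eqF ?mul0rn // (leq_ltn_trans _ lt_mi) // -ltnS.
have szh : (size h' <= 2 * q1)%N.
  rewrite (leq_trans (size_polyMleq _ _)) // size_polyXn.
  have : (size (1 - ('X + 1 : {poly F}) ^+ m)%R <= m.+1)%N.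
    rewrite (leq_trans (size_polyD _ _)) // geq_max size_polyN size_poly1 /=.
    rewrite (leq_trans (size_poly_exp_leq _ _)) // -[1]/(1%:P) size_XaddC /= mul1n.
    by [].
  move=> szm; rewrite addSn /= mul2n -addnn leq_add ?leq_subr // (leq_trans szm) //.
  by rewrite -m2 muln2 -addnn -addn1 leq_add2l.
rewrite sum_horner // coefXnM ltnNge leq_subr /= subKn // coefB coefh coef1.
by ring.
Qed.

(** * Reduction modulo p *)

Lemma comp_map_poly_def (R : comNzRingType) n (c : nat -> int) (g : {poly R}) :
  map_poly intr (\poly_(k < n) c k) \Po g = \sum_(k < n) (c k)%:~R *: g ^+ k.
Proof.
rewrite poly_def rmorph_sum /= (rmorph_sum (comp_poly g)) /=.
apply: eq_bigr => k _.
by rewrite map_polyZ map_polyXn comp_polyZ (rmorphXn (comp_poly g)) /= comp_polyX.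
Qed.

Definition half_compl (F : fieldType) : {poly F} := 2^-1 *: (1 - 'X).

Lemma map_poly_1sub2X (R : nzRingType) :
  map_poly (intr : int -> R) (1 - 2 *: 'X) = 1 - 2 *: 'X.
Proof. by rewrite rmorphB /= rmorph1 map_polyZ map_polyX /= rmorph_nat. Qed.

Lemma comp_1sub2X_half (F : fieldType) : 2 != 0 :> F ->
  (1 - 2 *: 'X) \Po half_compl F = 'X.
Proof.
move=> two0; rewrite comp_polyB comp_polyZ comp_polyX comp_polyC.
by rewrite /half_compl scalerA divff // scale1r; ring.
Qed.

Lemma legendre_comp n :
  legendre n = map_poly intr (legendre_shift n) \Po half_compl rat.
Proof.
have rec m : (m.+2%:R : rat) *: (map_poly intr (legendre_shift m.+2) \Po half_compl rat) =
  (2 * m.+1 + 1)%:R *: ('X * (map_poly intr (legendre_shift m.+1) \Po half_compl rat))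
  - m.+1%:R *: (map_poly intr (legendre_shift m) \Po half_compl rat).
  have := congr1 (fun q => map_poly (intr : int -> rat) q \Po half_compl rat) (legendre_shift_rec m).
  rewrite /= rmorphB /= !map_polyZ /= rmorphM /= map_poly_1sub2X !rmorph_nat.
  by rewrite comp_polyB !comp_polyZ comp_polyM comp_1sub2X_half.
have [] : legendre n = map_poly intr (legendre_shift n) \Po half_compl rat /\
  legendre n.+1 = map_poly intr (legendre_shift n.+1) \Po half_compl rat; last by [].
elim: n => [|n [IH0 IH1]].
  split.
    have -> : legendre_shift 0 = 1.
      apply/polyP => -[|k]; rewrite coef_legendre_shift coef1 ?legendre_coef0 //.
      by rewrite /legendre_coef legendre_binom_small // mulr0.
    by rewrite rmorph1 comp_polyC.
  have -> : legendre_shift 1 = 1 - 2 *: 'X.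
    apply/polyP => -[|[|k]]; rewrite coef_legendre_shift coefB coef1 coefZ coefX ?legendre_coef0 //.
    by rewrite /legendre_coef legendre_binom_small // mulr0.
  by rewrite map_poly_1sub2X comp_1sub2X_half.
split=> //.
have n2 : n.+2%:R != 0 :> rat by rewrite pnatr_eq0.
apply: (scalerI n2); rewrite rec -IH0 -IH1.
exact: legendreS.
Qed.

(** The fraction a / b need not be reduced: the reduced denominator divides b, so it
    is still invertible in F. *)
Lemma ratr_frac (F : fieldType) (a b : int) : b%:~R != 0 :> F ->
  ratr (a%:~R / b%:~R) = a%:~R / b%:~R :> F.
Proof.
move=> bF; rewrite /ratr; case: (divqP a b) bF => [_ /eqP //|k x k0].
rewrite !intrM mulf_eq0 negb_or => /andP[kF _].
by rewrite -mulf_div divff // mul1r.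
Qed.

(** Since ratr is not a ring morphism into a field of positive characteristic, the
    polynomial is first put over the common denominator 2 ^ (size f); only the
    coefficients of the result, fractions of integers, are then reduced. *)
Lemma map_ratr_comp_half (F : fieldType) (f : {poly int}) : 2 != 0 :> F ->
  map_poly (ratr : rat -> F) (map_poly intr f \Po half_compl rat) =
  map_poly intr f \Po half_compl F.
Proof.
move=> two0.
pose g : {poly int} := \sum_(k < size f) (f`_k * 2 ^+ (size f - k)) *: (1 - 'X) ^+ k.
have gE (K : fieldType) : 2 != 0 :> K ->
    map_poly intr f \Po half_compl K = (2 ^+ size f)^-1 *: map_poly intr g.
  move=> K2; rewrite /g (rmorph_sum _) scaler_sumr /= -[f in LHS]coefK comp_map_poly_def.
  apply: eq_bigr => k _ /=.
  rewrite map_polyZ rmorphXn /= rmorphB /= rmorph1 map_polyX.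
  rewrite scalerA /half_compl exprZn scalerA; congr (_ *: _).
  rewrite intrM rmorphXn /= exprVn mulrCA; congr (_ * _).
  apply: (mulfI (expf_neq0 (size f) K2)).
  rewrite mulrA divff ?expf_neq0 // mul1r.
  apply: (mulIf (expf_neq0 k K2)).
  by rewrite -mulrA mulVf ?expf_neq0 // mulr1 -exprD subnK // ltnW.
rewrite (gE rat) // (gE F two0).
apply/polyP => i; rewrite coef_map_id0; last by rewrite /ratr mul0r.
rewrite !coefZ !coef_map /= mulrC [RHS]mulrC.
have e (K : fieldType) : 2 ^+ size f = ((2 : int) ^+ size f)%:~R :> K by rewrite rmorphXn.
by rewrite !e ratr_frac // -e expf_neq0.
Qed.

Lemma natr_Fp_neq0 (p n : nat) : prime p -> (0 < n < p)%N -> n%:R != 0 :> 'F_p.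
Proof.
move=> p_prime /andP[n0 np].
rewrite -(dvdn_pcharf (pchar_Fp p_prime)).
by rewrite gtnNdvd.
Qed.

(** Both sides satisfy the same first-order recurrence in k, because
    2 (m - k) = - (2 k + 1) in F_p for m = (p - 1) / 2, and k + 1 is invertible.  Beyond
    k = m both sides are zero. *)
Lemma bin_half_mod (p k : nat) : prime p -> odd p -> (k < p)%N ->
  4 ^+ k * 'C((p - 1)./2, k)%:R = (-1) ^+ k * 'C(2 * k, k)%:R :> 'F_p.
Proof.
move=> p_prime p_odd; elim: k => [|k IH] ltk; first by rewrite !bin0.
have {}IH := IH (ltnW ltk).
apply: (mulfI (natr_Fp_neq0 p_prime (ltk : 0 < k.+1 < p)%N)).
have e1 := congr1 (fun x => x%:R : 'F_p) (central_binS k).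
have e2 := congr1 (fun x => x%:R : 'F_p) (mul_bin_left (p - 1)./2 k).
have m2 : 2 * ((p - 1)./2)%:R = -1 :> 'F_p.
  rewrite -natrM mul2n even_halfK ?oddB ?prime_gt0 ?p_odd //.
  by rewrite natrB ?prime_gt0 // pchar_Fp_0 // sub0r.
move: IH e1 e2 m2; move: 'C(2 * k.+1, k.+1) 'C(2 * k, k) => c' c.
have [le_km|lt_mk] := leqP k (p - 1)./2.
  move: 'C(_, k) 'C(_, k.+1) => b b'; rewrite !natrM natrB // => IH e1 e2 m2.
  move: e1; rewrite natrD natrM => e1.
  transitivity (4 * 4 ^+ k * (k.+1%:R * b'%:R) : 'F_p); first by rewrite exprS; ring.
  rewrite e2 exprS.
  transitivity (- (-1) ^+ k * (k.+1%:R * c'%:R) : 'F_p); last by ring.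
  rewrite e1.
  transitivity ((2 * (2 * ((p - 1)./2)%:R) - 4 * k%:R) * (4 ^+ k * b%:R) : 'F_p); first by ring.
  by rewrite IH m2; ring.
rewrite !bin_small ?(leqW lt_mk) //= => IH e1 _ _.
have c0 : c%:R = 0 :> 'F_p.
  by move/esym/eqP: IH; rewrite mulr0 mulf_eq0 signr_eq0 => /eqP.
rewrite !mulr0 mulrCA; move: e1; rewrite !natrM c0 mulr0 => ->.
by rewrite mulr0.
Qed.

(** * The congruence *)

Theorem mainTheorem4 (p r : nat) (p_prime : prime p) (p_odd : odd p)
    (le_r : (r <= p - 1)%N) :
  legendre_mod p r ^+ 2 =
    1 + (legendre_mod p r \Po (2%:R *: 'X^2 - 1))
    + 2%:R *: (\sum_(y : 'F_p | nonresidue y)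
        (legendre_mod p r \Po
          ((y - 1)^-1 *: ((y + 1)%:P - 2%:R *: 'X^2)))).
Proof.
have p2 : (2 < p)%N by rewrite odd_prime_gt2.
have lt_rp : (r < p)%N by rewrite -(prednK (prime_gt0 p_prime)) ltnS -subn1.
have two0 : 2 != 0 :> 'F_p by rewrite natr_Fp_neq0.
have four0 : 4 != 0 :> 'F_p by rewrite (natrM _ 2 2) mulf_neq0.
have lmE : legendre_mod p r = map_poly intr (legendre_shift r) \Po half_compl 'F_p.
  by rewrite /legendre_mod legendre_comp map_ratr_comp_half.
have half_comp (g : {poly 'F_p}) : half_compl 'F_p \Po g = 2^-1 *: (1 - g).
  by rewrite /half_compl comp_polyZ comp_polyB comp_polyC comp_polyX.
pose a k : 'F_p := (legendre_coef r k)%:~R.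
pose w : {poly 'F_p} := 'X^2 - 1.
have sqE : legendre_mod p r ^+ 2 =
    \sum_(k < r.+1) (a k * 'C((p - 1)./2, k)%:R) *: w ^+ k.
  rewrite lmE -(rmorphXn (comp_poly _)) /= -rmorphXn /= clausen_legendre.
  rewrite map_comp_poly -comp_polyA rmorphB /= map_polyX map_polyXn.
  rewrite comp_polyB comp_polyX (rmorphXn (comp_poly _)) /= comp_polyX.
  have -> : half_compl 'F_p - half_compl 'F_p ^+ 2 = (- 4^-1) *: w.
    have h2 : 2 *: half_compl 'F_p = 1 - 'X.
      by rewrite /half_compl scalerA divff // scale1r.
    apply: (scalerI four0); rewrite scalerA mulrN divff // scaleN1r.
    transitivity (2 *: (2 *: half_compl 'F_p) - (2 *: half_compl 'F_p) ^+ 2).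
      by rewrite -!mul_polyC; ring.
    by rewrite h2 /w -!mul_polyC; ring.
  rewrite comp_map_poly_def; apply: eq_bigr => k _.
  rewrite exprZn scalerA intrM -/(a k) -mulrA; congr ((_ * _) *: _).
  apply: (mulfI (expf_neq0 k four0)).
  rewrite bin_half_mod //; last first.
    exact: leq_trans (ltn_ord k) lt_rp.
  rewrite mulrCA -exprMn mulrN divff // mulrC.
  by rewrite rmorph_nat.
have resE : legendre_mod p r \Po (2 *: 'X^2 - 1) =
    \sum_(k < r.+1) (a k * (-1) ^+ k) *: w ^+ k.
  rewrite lmE -comp_polyA half_comp.
  have -> : 2^-1 *: (1 - (2 *: 'X^2 - 1)) = (-1) *: w.
    rewrite scaleN1r; apply: (scalerI two0); rewrite scalerA divff // scale1r /w.
    by rewrite -!mul_polyC; ring.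
  by rewrite comp_map_poly_def; apply: eq_bigr => k _; rewrite exprZn scalerA.
have nonE (y : 'F_p) : nonresidue y ->
    legendre_mod p r \Po ((y - 1)^-1 *: ((y + 1)%:P - 2 *: 'X^2)) =
    \sum_(k < r.+1) (a k * (y - 1)^-1 ^+ k) *: w ^+ k.
  move=> /andP[y0 nsq].
  have y1 : y - 1 != 0.
    rewrite subr_eq0; apply: contraNneq nsq => ->.
    by apply/existsP; exists 1; rewrite oner_eq0 expr1n eqxx.
  rewrite lmE -comp_polyA half_comp.
  have -> : 2^-1 *: (1 - (y - 1)^-1 *: ((y + 1)%:P - 2 *: 'X^2)) = (y - 1)^-1 *: w.
    apply: (scalerI two0); rewrite scalerA divff // scale1r.
    apply: (scalerI y1); rewrite scalerBr !scalerA divff // scale1r mulrAC divff // mul1r.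
    by rewrite /w -!mul_polyC polyCB polyCD; ring.
  by rewrite comp_map_poly_def; apply: eq_bigr => k _; rewrite exprZn scalerA.
rewrite sqE resE (eq_bigr _ nonE) exchange_big /= scaler_sumr.
(* The summand 1 is the term k = 0, which cancels the correction at k = 0 in
   sum_nonsquare. *)
have -> : 1 = \sum_(k < r.+1) (a k * (k == 0 :> nat)%:R) *: w ^+ k.
  rewrite big_ord_recl big1 ?addr0 => [|k _]; last by rewrite mulr0 scale0r.
  by rewrite /a legendre_coef0 !mulr1 scale1r.
rewrite -!big_split /=; apply: eq_bigr => k _.
rewrite -scaler_suml scalerA -!scalerDl; congr (_ *: _).
rewrite -mulr_sumr mulrCA -!mulrDr; congr (_ * _).
have := @sum_nonsquare 'F_p k; rewrite card_Fp // => /(_ p_odd).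
rewrite /nonresidue => ->; first by ring.
by rewrite (leq_trans _ le_r) // -ltnS.
Qed.
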